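(* Let $\mathbb T=(T,\mu,\eta)$ be a strongly finitary monad on $\mathbf{Pos}$. Then $\mathbb T$ is (up to isomorphism of monads) the free-algebra monad of its associated variety $\mathcal V_{\mathbb T}$ of ordered algebras.
   Context: $\mathbf{Pos}$ is the category of posets and monotone maps, enriched over itself with hom-sets ordered pointwise. All functors, (co)limits and monads are understood to be enriched over $\mathbf{Pos}$; in particular the underlying functor of every monad on $\mathbf{Pos}$ is locally monotone. Coinserters: the coinserter of an ordered pair $f_0,f_1:A\to B$ of monotone maps is a monotone map $c:B\to C$ with $c f_0\le c f_1$ such that every $u:B\to D$ with $u f_0\le u f_1$ factorises as $u=vc$ for a unique $v$, and moreover $vc\le v'c$ implies $v\le v'$. The pair is reflexive if there is $i:B\to A$ with $f_0 i=\mathrm{id}_B=f_1 i$. A monad on $\mathbf{Pos}$ is strongly finitary if its underlying endofunctor preserves filtered colimits and coinserters of reflexive pairs (equivalently, it is the enriched left Kan extension of its restriction along the full embedding into $\mathbf{Pos}$ of the finite discrete posets $n=\{0,\dots,n-1\}$, $n\in\mathbb N$). Varieties: a signature $\Sigma$ is a collection of sets $\Sigma_n$ ($n\in\mathbb N$) of $n$-ary operation symbols. An ordered $\Sigma$-algebra is a poset $A$ with a monotone map $\sigma_A:A^n\to A$ for every $n$ and $\sigma\in\Sigma_n$; homomorphisms are monotone maps preserving the operations. Let $V=\{x_n\mid n\in\mathbb N\}$ be a fixed set of variables and $T_\Sigma V$ the set of $\Sigma$-terms over $V$. An inequation is an ordered pair of terms of $T_\Sigma V$, written $u\le v$; an algebra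 $A$ satisfies it if $f^\sharp(u)\le f^\sharp(v)$ for every map $f:V\to|A|$, where $f^\sharp:T_\Sigma V\to A$ is the homomorphism extending $f$. An equation $u=v$ stands for the two inequations $u\le v$ and $v\le u$. A variety of ordered $\Sigma$-algebras is the full subcategory of the category of ordered $\Sigma$-algebras given by all algebras satisfying a given set of inequations. Every variety $\mathcal V$ has free algebras on all posets, and its free-algebra monad $\mathbb T_{\mathcal V}$ on $\mathbf{Pos}$ is the monad of the adjunction given by the forgetful functor $\mathcal V\to\mathbf{Pos}$ and its left adjoint. Associated variety: each natural number $n$ is regarded as the discrete poset $\{0,\dots,n-1\}$. For $k:X\to TY$ put $k^*=\mu_Y\circ Tk:TX\to TY$. The variety $\mathcal V_{\mathbb T}$ has the signature $\Sigma$ with $\Sigma_n$ the set of elements of $Tn$ ($n\in\mathbb N$); with each $n$-ary symbol $\sigma$ is associated the term $\sigma(x_i)=\sigma(x_0,\dots,x_{n-1})$ over $V$. It is presented by the following inequations, with $n,m$ ranging over $\mathbb N$: (1) $\sigma(x_i)\le\tau(x_i)$ for all $\sigma\le\tau$ in $Tn$; (2) $k^*(\sigma)(x_i)=\sigma\bigl(k_0(x_i),\dots,k_{m-1}(x_i)\bigr)$ for all $m$-tuples $k=(k_0,\dots,k_{m-1}):m\to Tn$ and all $\sigma\in Tm$.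
   Formalization: The presentation of the associated variety is completed by the equations η_n(i)(x_0,…,x_{n-1}) = x_i for i<n; with (1) and (2) alone the claim fails, e.g. for the identity monad, where the symbols may act as an idempotent map e(x_i). *)

(* Defs.v *)
From HB Require Import structures.
From mathcomp Require Import all_boot all_order.

Set Implicit Arguments.
Unset Strict Implicit.
Unset Printing Implicit Defensive.

Import Order.TTheory.
Local Open Scope order_scope.

(** * The category of posets *)

(* Objects are MathComp's partial orders and morphisms the bundled monotone
   maps {omorphism A -> B}, compared with =1 and ordered pointwise.  An object
   carries a boolean order and a choice operator; classically every poset does.
   The display is a phantom parameter, fixed once and for all. *)
Notation Pos := (porderType (Order.Disp tt tt)).

Definition mle (A B : Pos) (f g : {omorphism A -> B}) : Prop :=
  forall x, f x <= g x.

Definition midmap (A : Pos) : {omorphism A -> A} := idfun.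

Definition mcomp (A B C : Pos) (g : {omorphism B -> C})
  (f : {omorphism A -> B}) : {omorphism A -> C} := g \o f.

Definition discrete (T : Type) : Type := T.

Section Discrete.
Variable T : choiceType.
HB.instance Definition _ := Choice.on (discrete T).

Fact discrete_refl : reflexive (@eq_op (discrete T)).
Proof. exact: eqxx. Qed.
Fact discrete_anti : antisymmetric (@eq_op (discrete T)).
Proof. by move=> x y /andP[/eqP]. Qed.
Fact discrete_trans : transitive (@eq_op (discrete T)).
Proof. exact: eq_op_trans. Qed.

HB.instance Definition _ := Order.Le_isPOrder.Build (Order.Disp tt tt)
  (discrete T) discrete_refl discrete_anti discrete_trans.
End Discrete.

(* The natural number n as the discrete poset {0, ..., n-1}. *)
Definition dnat (n : nat) : Pos := discrete 'I_n.

Section FromDiscrete.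
Variables (n : nat) (Y : Pos) (k : 'I_n -> Y).
Definition of_tuple_fun (i : dnat n) : Y := k i.
Fact of_tuple_fun_monotone : {homo of_tuple_fun : x y / x <= y}.
Proof. by move=> x y /eqP ->. Qed.
HB.instance Definition _ := Order.isOrderMorphism.Build _ (dnat n) _ Y
  of_tuple_fun of_tuple_fun_monotone.
(* The n-tuple k, viewed as a morphism from the discrete poset n. *)
Definition of_tuple : {omorphism dnat n -> Y} := of_tuple_fun.
End FromDiscrete.

(** * Coinserters and filtered colimits *)

Definition is_coinserter (A B C : Pos) (f0 f1 : {omorphism A -> B})
    (c : {omorphism B -> C}) : Prop :=
  [/\ mle (mcomp c f0) (mcomp c f1),
      forall (D : Pos) (u : {omorphism B -> D}),
        mle (mcomp u f0) (mcomp u f1) ->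
        exists v : {omorphism C -> D}, mcomp v c =1 u /\
          forall v' : {omorphism C -> D}, mcomp v' c =1 u -> v' =1 v
    & forall (D : Pos) (v v' : {omorphism C -> D}),
        mle (mcomp v c) (mcomp v' c) -> mle v v'].

Definition reflexive_pair (A B : Pos) (f0 f1 : {omorphism A -> B}) : Prop :=
  exists i : {omorphism B -> A},
    mcomp f0 i =1 midmap B /\ mcomp f1 i =1 midmap B.

(* Objects and homs are choiceTypes rather than arbitrary Types: this places
   them in the same universe as the carriers of posets, i.e. makes the
   category small. *)
Record small_category := SmallCategory {
  ob :> choiceType;
  hom : ob -> ob -> choiceType;
  idm : forall i, hom i i;
  compm : forall i j k, hom j k -> hom i j -> hom i k;
  compm1 : forall i j (f : hom i j), compm f (idm i) = f;
  comp1m : forall i j (f : hom i j), compm (idm j) f = f;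
  compmA : forall i j k l (h : hom k l) (g : hom j k) (f : hom i j),
    compm h (compm g f) = compm (compm h g) f }.

Definition filtered (J : small_category) : Prop :=
  [/\ inhabited J,
      forall i j : J, exists k : J, inhabited (hom i k) /\ inhabited (hom j k)
    & forall (i j : J) (f g : hom i j),
        exists (k : J) (h : hom j k), compm h f = compm h g].

Record diagram (J : small_category) := Diagram {
  dob :> J -> Pos;
  dmap : forall i j, hom i j -> {omorphism dob i -> dob j};
  dmap_id : forall i, dmap (idm i) =1 midmap (dob i);
  dmap_comp : forall i j k (g : hom j k) (f : hom i j),
    dmap (compm g f) =1 mcomp (dmap g) (dmap f) }.

Definition is_colimit (J : small_category) (D : diagram J) (C : Pos)
    (c : forall i, {omorphism D i -> C}) : Prop :=
  [/\ forall i j (f : hom i j), mcomp (c j) (dmap D f) =1 c i,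
      forall (E : Pos) (u : forall i, {omorphism D i -> E}),
        (forall i j (f : hom i j), mcomp (u j) (dmap D f) =1 u i) ->
        exists v : {omorphism C -> E}, (forall i, mcomp v (c i) =1 u i) /\
          forall v' : {omorphism C -> E},
            (forall i, mcomp v' (c i) =1 u i) -> v' =1 v
    & forall (E : Pos) (v v' : {omorphism C -> E}),
        (forall i, mle (mcomp v (c i)) (mcomp v' (c i))) -> mle v v'].

(** * Enriched endofunctors and monads *)

Record functor := Functor {
  fobj :> Pos -> Pos;
  fmap : forall A B : Pos, {omorphism A -> B} -> {omorphism fobj A -> fobj B};
  fmap_id : forall A, fmap (midmap A) =1 midmap (fobj A);
  fmap_comp : forall (A B C : Pos) (g : {omorphism B -> C})
    (f : {omorphism A -> B}), fmap (mcomp g f) =1 mcomp (fmap g) (fmap f);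
  fmap_mono : forall (A B : Pos) (f g : {omorphism A -> B}),
    mle f g -> mle (fmap f) (fmap g) }.

Lemma fmap_ext (F : functor) (A B : Pos) (f g : {omorphism A -> B}) :
  f =1 g -> fmap F f =1 fmap F g.
Proof.
move=> fg x; apply/le_anti/andP.
by split; apply: fmap_mono => y; rewrite fg.
Qed.

Section MapDiagram.
Variables (F : functor) (J : small_category) (D : diagram J).

Fact map_diagram_id i : fmap F (dmap D (idm i)) =1 midmap (F (D i)).
Proof. by move=> x; rewrite (fmap_ext (@dmap_id _ D i)) fmap_id. Qed.

Fact map_diagram_comp i j k (g : hom j k) (f : hom i j) :
  fmap F (dmap D (compm g f)) =1 mcomp (fmap F (dmap D g)) (fmap F (dmap D f)).
Proof. by move=> x; rewrite (fmap_ext (@dmap_comp _ D _ _ _ g f)) fmap_comp. Qed.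

Definition map_diagram : diagram J := Diagram map_diagram_id map_diagram_comp.
End MapDiagram.

Definition preserves_filtered_colimits (F : functor) : Prop :=
  forall (J : small_category) (D : diagram J) (C : Pos)
    (c : forall i, {omorphism D i -> C}),
    filtered J -> is_colimit c ->
    is_colimit (D := map_diagram F D) (fun i => fmap F (c i)).

Definition preserves_reflexive_coinserters (F : functor) : Prop :=
  forall (A B C : Pos) (f0 f1 : {omorphism A -> B}) (c : {omorphism B -> C}),
    reflexive_pair f0 f1 -> is_coinserter f0 f1 c ->
    is_coinserter (fmap F f0) (fmap F f1) (fmap F c).

Record monad := Monad {
  mfun :> functor;
  eta : forall X : Pos, {omorphism X -> mfun X};
  mu : forall X : Pos, {omorphism mfun (mfun X) -> mfun X};
  eta_natural : forall (X Y : Pos) (f : {omorphism X -> Y}),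
    mcomp (fmap mfun f) (eta X) =1 mcomp (eta Y) f;
  mu_natural : forall (X Y : Pos) (f : {omorphism X -> Y}),
    mcomp (fmap mfun f) (mu X) =1 mcomp (mu Y) (fmap mfun (fmap mfun f));
  mu_eta : forall X, mcomp (mu X) (eta (mfun X)) =1 midmap (mfun X);
  mu_fmap_eta : forall X, mcomp (mu X) (fmap mfun (eta X)) =1 midmap (mfun X);
  mu_mu : forall X, mcomp (mu X) (mu (mfun X)) =1 mcomp (mu X) (fmap mfun (mu X)) }.

Definition strongly_finitary (T : monad) : Prop :=
  preserves_filtered_colimits T /\ preserves_reflexive_coinserters T.

(* k^* = mu_Y \o T k *)
Definition kstar (T : monad) (X Y : Pos) (k : {omorphism X -> T Y}) :
  {omorphism T X -> T Y} := mcomp (mu T Y) (fmap T k).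

Definition monad_morphism (S T : monad) (phi : forall X, {omorphism S X -> T X}) :
    Prop :=
  [/\ forall (X Y : Pos) (f : {omorphism X -> Y}),
        mcomp (fmap T f) (phi X) =1 mcomp (phi Y) (fmap S f),
      forall X, mcomp (phi X) (eta S X) =1 eta T X
    & forall X, mcomp (phi X) (mu S X) =1
        mcomp (mu T X) (mcomp (phi (T X)) (fmap S (phi X)))].

Definition monad_iso (S T : monad) : Prop :=
  exists (phi : forall X, {omorphism S X -> T X})
         (psi : forall X, {omorphism T X -> S X}),
    [/\ monad_morphism phi, monad_morphism psi,
        forall X, mcomp (psi X) (phi X) =1 midmap (S X)
      & forall X, mcomp (phi X) (psi X) =1 midmap (T X)].

(** * Varieties of ordered algebras *)

Definition signature := nat -> Type.

Record algebra (S : signature) := Algebra {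
  acar :> Pos;
  aop : forall n, S n -> ('I_n -> acar) -> acar;
  aop_mono : forall n (s : S n) (a b : 'I_n -> acar),
    (forall i, a i <= b i) -> aop s a <= aop s b }.

Definition is_hom (S : signature) (A B : algebra S) (h : {omorphism A -> B}) :
    Prop :=
  forall n (s : S n) (a : 'I_n -> A), h (aop s a) = aop s (fun i => h (a i)).

(* Terms over the variables x_0, x_1, ... *)
Inductive term (S : signature) :=
| Var of nat
| Op n of S n & ('I_n -> term S).
Arguments Var {S}.

Fixpoint eval (S : signature) (A : algebra S) (f : nat -> A) (t : term S) : A :=
  match t with
  | Var j => f j
  | Op n s ts => aop s (fun i => eval f (ts i))
  end.

Record variety := Variety {
  vsig : signature;
  vineq : term vsig -> term vsig -> Prop }.

Definition satisfies (V : variety) (A : algebra (vsig V)) : Prop :=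
  forall u v, vineq u v -> forall f : nat -> A, eval f u <= eval f v.

Record valgebra (V : variety) := VAlgebra {
  valg :> algebra (vsig V);
  valgP : satisfies valg }.

(* A left adjoint to the forgetful functor from V to posets, presented by
   universal arrows; ext_mono says that the adjunction is enriched. *)
Record free_algebras (V : variety) := FreeAlgebras {
  free : Pos -> valgebra V;
  funit : forall X : Pos, {omorphism X -> free X};
  ext : forall (X : Pos) (A : valgebra V),
    {omorphism X -> A} -> {omorphism free X -> A};
  ext_hom : forall (X : Pos) (A : valgebra V) (f : {omorphism X -> A}),
    is_hom (ext f);
  ext_unit : forall (X : Pos) (A : valgebra V) (f : {omorphism X -> A}),
    mcomp (ext f) (funit X) =1 f;
  ext_uniq : forall (X : Pos) (A : valgebra V) (f : {omorphism X -> A})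
    (h : {omorphism free X -> A}),
    is_hom h -> mcomp h (funit X) =1 f -> h =1 ext f;
  ext_mono : forall (X : Pos) (A : valgebra V) (f g : {omorphism X -> A}),
    mle f g -> mle (ext f) (ext g) }.

Section FreeMonad.
Variables (V : variety) (F : free_algebras V).
Implicit Types X Y Z : Pos.

Lemma hom_comp (A B C : valgebra V) (g : {omorphism B -> C})
  (f : {omorphism A -> B}) : is_hom g -> is_hom f -> is_hom (mcomp g f).
Proof. by move=> gh fh n s a; rewrite /mcomp/= fh gh. Qed.

Lemma hom_id (A : valgebra V) : is_hom (A := A) (B := A) (midmap A).
Proof. by []. Qed.

Lemma hom_eq X (A : valgebra V) (g h : {omorphism free F X -> A}) :
  is_hom g -> is_hom h -> mcomp g (funit F X) =1 mcomp h (funit F X) -> g =1 h.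
Proof.
move=> gh hh gE x; rewrite (ext_uniq gh gE).
by rewrite (ext_uniq (f := mcomp h (funit F X)) hh).
Qed.

Definition free_fmap X Y (f : {omorphism X -> Y}) :
  {omorphism free F X -> free F Y} := ext F (mcomp (funit F Y) f).

Lemma free_fmap_hom X Y (f : {omorphism X -> Y}) : is_hom (free_fmap f).
Proof. exact: ext_hom. Qed.

Fact free_fmap_unit X Y (f : {omorphism X -> Y}) :
  mcomp (free_fmap f) (funit F X) =1 mcomp (funit F Y) f.
Proof. exact: ext_unit. Qed.

Fact free_fmap_id X : free_fmap (midmap X) =1 midmap (free F X).
Proof.
apply: (hom_eq (free_fmap_hom _) (@hom_id _)) => x.
by rewrite free_fmap_unit.
Qed.

Fact free_fmap_comp X Y Z (g : {omorphism Y -> Z}) (f : {omorphism X -> Y}) :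
  free_fmap (mcomp g f) =1 mcomp (free_fmap g) (free_fmap f).
Proof.
apply: (hom_eq (free_fmap_hom _) (hom_comp (free_fmap_hom _) (free_fmap_hom _))).
move=> x; rewrite free_fmap_unit /mcomp/=.
by rewrite [free_fmap f _]free_fmap_unit [RHS]free_fmap_unit.
Qed.

Fact free_fmap_mono X Y (f g : {omorphism X -> Y}) :
  mle f g -> mle (free_fmap f) (free_fmap g).
Proof. by move=> fg; apply: ext_mono => x; apply: (omorph_le (funit F Y)); apply: fg. Qed.

Definition free_functor : functor :=
  Functor free_fmap_id free_fmap_comp free_fmap_mono.

(* The counit of the adjunction at the free algebra on X. *)
Definition free_mu X : {omorphism free_functor (free_functor X) -> free_functor X} :=
  ext F (A := free F X) (midmap (free F X)).

Lemma free_mu_hom X : is_hom (A := free F (free F X)) (B := free F X) (free_mu X).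
Proof. exact: ext_hom. Qed.

Fact free_mu_eta X :
  mcomp (free_mu X) (funit F (free_functor X)) =1 midmap (free_functor X).
Proof. exact: ext_unit. Qed.

Fact free_mu_natural X Y (f : {omorphism X -> Y}) :
  mcomp (free_fmap f) (free_mu X) =1
  mcomp (free_mu Y) (free_fmap (fmap free_functor f)).
Proof.
apply: hom_eq.
- exact: hom_comp (free_fmap_hom _) (@free_mu_hom _).
- exact: hom_comp (@free_mu_hom _) (free_fmap_hom _).
move=> x; rewrite /mcomp/= [free_mu X _]free_mu_eta /=.
by rewrite [free_fmap _ (funit _ _ _)]free_fmap_unit [RHS]free_mu_eta.
Qed.

Fact free_mu_fmap_eta X :
  mcomp (free_mu X) (free_fmap (funit F X)) =1 midmap (free_functor X).
Proof.
apply: hom_eq.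
- exact: hom_comp (@free_mu_hom _) (free_fmap_hom _).
- exact: hom_id.
move=> x; rewrite /mcomp/= [free_fmap _ (funit _ _ _)]free_fmap_unit.
exact: free_mu_eta.
Qed.

Fact free_mu_mu X :
  mcomp (free_mu X) (free_mu (free_functor X)) =1
  mcomp (free_mu X) (free_fmap (free_mu X)).
Proof.
apply: hom_eq.
- exact: hom_comp (@free_mu_hom _) (@free_mu_hom _).
- exact: hom_comp (@free_mu_hom _) (free_fmap_hom _).
move=> x; rewrite /mcomp/= [free_mu (free_functor X) _]free_mu_eta.
rewrite [free_fmap _ (funit _ _ _)]free_fmap_unit /=.
by rewrite [RHS]free_mu_eta.
Qed.

Definition free_monad : monad :=
  @Monad free_functor (funit F) free_mu
    (fun X Y f => free_fmap_unit f) free_mu_natural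
    free_mu_eta free_mu_fmap_eta free_mu_mu.
End FreeMonad.

(** * The variety associated with a monad *)

Section AssociatedVariety.
Variable T : monad.

Definition assoc_sig : signature := fun n => T (dnat n).

(* sigma(x_0, ..., x_{n-1}) *)
Definition op_term n (s : T (dnat n)) : term assoc_sig :=
  Op (S := assoc_sig) s (fun i : 'I_n => Var i).

Inductive assoc_eq : term assoc_sig -> term assoc_sig -> Prop :=
| assoc_eq_subst n m (k : 'I_m -> T (dnat n)) (s : T (dnat m)) :
    assoc_eq (op_term (kstar (of_tuple k) s))
             (Op (S := assoc_sig) s (fun j => op_term (k j)))
(* The symbol eta_n(i) is the i-th projection.  This does not follow from
   assoc_eq_subst: for the identity monad, interpreting every eta_n(i) as
   e(x_i) with e an idempotent monotone map satisfies all the other laws. *)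
| assoc_eq_unit n (i : 'I_n) :
    assoc_eq (op_term (eta T (dnat n) i)) (Var i).

Inductive assoc_ineq : term assoc_sig -> term assoc_sig -> Prop :=
| assoc_ineq_le n (s t : T (dnat n)) :
    s <= t -> assoc_ineq (op_term s) (op_term t)
| assoc_ineq_eq u v : assoc_eq u v -> assoc_ineq u v
| assoc_ineq_eq_sym u v : assoc_eq u v -> assoc_ineq v u.

Definition associated_variety : variety := Variety assoc_ineq.
End AssociatedVariety.

(* Main.v *)
From HB Require Import structures.
From mathcomp Require Import all_boot all_order.
From mathcomp.classical Require Import boolp.
Require Import Defs.

Set Implicit Arguments.
Unset Strict Implicit.
Unset Printing Implicit Defensive.

(** Each T X is an algebra for the operations s(k) = k^*(s), where s is an
    element of T n and k an n-tuple in T X; the Kleisli laws of T are exactly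
    what makes it satisfy the inequations of the associated variety.  The
    theorem amounts to T X being free on X, with unit eta: once this is known,
    T is the monad of one left adjoint to the forgetful functor
    ([monad_iso_monad_free]), and any two left adjoints give isomorphic monads
    ([free_monad_iso]).

    For a finite discrete n, a tuple a : n -> A in an algebra A extends to
    T n by sending the symbol s to its value s_A(a).  The inequations s <= t
    make this map monotone, the equations for k^*(s) make it a homomorphism,
    and the equations for eta make it an extension of a.

    An arbitrary poset X is reached from the finite discrete ones in two steps.
    A discrete poset is the filtered colimit of its finite subsets
    ([finite_colimit]), and X is the coinserter of a reflexive pair of discrete
    posets, namely the two projections to the set X from the set of pairs
    x <= y ([undiscrete_coinserter]).  Strong finitarity says that T preserves
    both colimits.  Two consequences carry the proof.  The universal
    properties glue the maps above into a monotone map T X -> A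
    ([monad_extension]).  And since the legs of a conical colimit, or a
    coinserter, are jointly surjective in posets ([colimit_cover],
    [coinserter_cover]), every element of T X has the form T t (s) for a tuple
    t : n -> X and s in T n ([finite_support]).  As
    T t (s) = s(eta t_0, ..., eta t_(n-1)), this determines every homomorphism
    out of T X by its values on eta, and it reduces the homomorphism property
    and the monotonicity of the extension to computations in T n. *)

Import Order.TTheory.
Local Open Scope order_scope.

(** * Monotone maps and subposets *)

Section MonotoneMap.
Variables (A B : Pos) (f : A -> B).
(** The proof of monotonicity is a phantom argument, from which instance
    resolution recovers the morphism structure. *)
Definition monotone_fun (_ : {homo f : x y / x <= y}) : A -> B := f.
Variable fP : {homo f : x y / x <= y}.
HB.instance Definition _ :=
  Order.isOrderMorphism.Build _ A _ B (monotone_fun fP) fP.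
Definition monotone_map : {omorphism A -> B} := monotone_fun fP.
End MonotoneMap.

Definition dpos (K : choiceType) : Pos := discrete K.

Lemma discrete_homo (K : choiceType) (Y : Pos) (k : K -> Y) :
  {homo (k : dpos K -> Y) : x y / x <= y}.
Proof. by move=> x y /eqP ->. Qed.

Definition of_fun (K : choiceType) (Y : Pos) (k : K -> Y) :
  {omorphism dpos K -> Y} := monotone_map (discrete_homo k).

Section SubPoset.
Variables (C : Pos) (P : pred C).
Definition subposet := {x : C | P x}.
HB.instance Definition _ := SubChoice.on subposet.
HB.instance Definition _ :=
  [SubChoice_isSubPOrder of subposet by <: with Order.Disp tt tt].

Lemma subposet_val_homo : {homo (val : subposet -> C) : x y / x <= y}.
Proof. by move=> x y; rewrite Order.le_val. Qed.

Definition subposet_val : {omorphism subposet -> C} :=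
  monotone_map subposet_val_homo.

Variables (B : Pos) (c : {omorphism B -> C}) (cP : forall b, P (c b)).
Definition corestrict_fun (b : B) : subposet := exist _ (c b) (cP b).
Lemma corestrict_homo : {homo corestrict_fun : x y / x <= y}.
Proof. by move=> x y xy; rewrite -Order.le_val; apply: (omorph_le c). Qed.
Definition corestrict : {omorphism B -> subposet} :=
  monotone_map corestrict_homo.
End SubPoset.

(** A coinserter is surjective: its corestriction to the subposet of the points
    that satisfy P factors through the coinserter itself, and by uniqueness the
    factorisation is a section of the inclusion of that subposet. *)
Lemma coinserter_cover (A B C : Pos) (f0 f1 : {omorphism A -> B})
    (c : {omorphism B -> C}) (P : C -> Prop) :
  is_coinserter f0 f1 c -> (forall b, P (c b)) -> forall y, P y.
Proof.
move=> [cle cuniv _] Pc y.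
have cP b : asbool (P (c b)) by apply/asboolP.
have [|v [vc _]] := cuniv _ (corestrict (P := fun x => asbool (P x)) cP).
  by move=> a; rewrite -Order.le_val; apply: cle.
have [w [_ wuniq]] := cuniv _ c cle.
have -> : y = val (v y); last by apply/asboolP/(valP (v y)).
rewrite -[RHS]/(mcomp (@subposet_val _ _) v y).
rewrite (wuniq (mcomp (@subposet_val _ _) v)).
  by rewrite -(wuniq (midmap C)).
by move=> b; apply: (congr1 val (vc b)).
Qed.

(** The legs of a colimit are jointly surjective, for the same reason as in
    [coinserter_cover]. *)
Lemma colimit_cover (J : small_category) (D : diagram J) (C : Pos)
    (c : forall i, {omorphism D i -> C}) (P : C -> Prop) :
  is_colimit c -> (forall i x, P (c i x)) -> forall y, P y.
Proof.
move=> [ccocone cuniv _] Pc y.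
have cP i x : asbool (P (c i x)) by apply/asboolP.
have [|v [vc _]] :=
    cuniv _ (fun i => corestrict (P := fun x => asbool (P x)) (cP i)).
  by move=> i j f x; apply: val_inj; apply: ccocone.
have [w [_ wuniq]] := cuniv _ c ccocone.
have -> : y = val (v y); last by apply/asboolP/(valP (v y)).
rewrite -[RHS]/(mcomp (@subposet_val _ _) v y).
rewrite (wuniq (mcomp (@subposet_val _ _) v)).
  by rewrite -(wuniq (midmap C)).
by move=> i x; apply: (congr1 val (vc i x)).
Qed.

(** * Discrete posets as filtered colimits of finite ones *)

Section FiniteSubsets.
Variable K : choiceType.
Implicit Types s t u : seq K.

(** A finite subset of K is represented by any list of its elements; removing
    duplicates makes the enumeration injective, so that a map between finite
    subsets over K is determined by its composite with the enumeration. *)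
Definition elem s : 'I_(size (undup s)) -> K := tnth (in_tuple (undup s)).

Lemma elem_mem s i : elem (s := s) i \in s.
Proof. by rewrite -mem_undup; apply: mem_tnth. Qed.

Lemma elem_inj s : injective (@elem s).
Proof. exact/tuple_uniqP/undup_uniq. Qed.

Definition position s x (xs : x \in s) : 'I_(size (undup s)) :=
  Ordinal (etrans (index_mem x (undup s)) (etrans (mem_undup s x) xs)).

Lemma elem_position s x (xs : x \in s) : elem (position xs) = x.
Proof. by rewrite /elem (tnth_nth x) nth_index // mem_undup. Qed.

(** The preorder of inclusions, seen as a type with at most one element, which
    makes the parallel-pair condition of filteredness trivial. *)
Definition inclusion s t := {_ : unit | all [in t] s}.

Definition subset_inclusion s t (st : {subset s <= t}) : inclusion s t :=
  exist _ tt (introT allP st).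

Lemma inclusion_sub s t (f : inclusion s t) : {subset s <= t}.
Proof. exact/allP/(valP f). Qed.

Lemma inclusion_irr s t (f g : inclusion s t) : f = g.
Proof. by apply: val_inj; case: (val f) (val g) => [] []. Qed.

Definition inclusion_id s : inclusion s s := subset_inclusion (fun _ => id).

Definition inclusion_comp s t u (g : inclusion t u) (f : inclusion s t) :
  inclusion s u :=
  subset_inclusion (fun x xs => inclusion_sub g (inclusion_sub f xs)).

Definition finite_subsets : small_category :=
  @SmallCategory (seq K) inclusion inclusion_id inclusion_comp
    (fun _ _ _ => inclusion_irr _ _) (fun _ _ _ => inclusion_irr _ _)
    (fun _ _ _ _ _ _ _ => inclusion_irr _ _).

Lemma finite_subsets_filtered : filtered finite_subsets.
Proof.
split; first by exists; exact: [::].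
  move=> s t; exists (s ++ t).
  by split; exists; apply: subset_inclusion => x xs;
    rewrite mem_cat xs ?orbT.
by move=> s t f g; exists t, (inclusion_id t); apply: inclusion_irr.
Qed.

Definition enlarge s t (f : inclusion s t) :
    {omorphism dnat (size (undup s)) -> dnat (size (undup t))} :=
  of_tuple (fun i => position (inclusion_sub f (elem_mem i)) : dnat _).

Lemma elem_enlarge s t (f : inclusion s t) i : elem (enlarge f i) = elem i.
Proof. exact: elem_position. Qed.

Fact enlarge_id s : enlarge (inclusion_id s) =1 midmap _.
Proof. by move=> i; apply: elem_inj; rewrite elem_enlarge. Qed.

Fact enlarge_comp s t u (g : inclusion t u) (f : inclusion s t) :
  enlarge (inclusion_comp g f) =1 mcomp (enlarge g) (enlarge f).
Proof.
move=> i; apply: elem_inj; rewrite elem_enlarge.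
by rewrite [RHS]elem_enlarge elem_enlarge.
Qed.

(** This brings arbitrary tuples, possibly with repeated entries, back to the
    duplicate-free enumerations that make up the diagram. *)
Lemma factor_elem n (k : 'I_n -> K) t : (forall i, k i \in t) ->
  exists g : {omorphism dnat n -> dnat (size (undup t))},
  forall i, elem (g i) = k i.
Proof.
move=> kt; exists (of_tuple (fun i => position (kt i) : dnat _)) => i.
exact: elem_position.
Qed.

Definition finite_diagram : diagram finite_subsets :=
  @Diagram finite_subsets (fun s => dnat (size (undup s))) enlarge
    enlarge_id enlarge_comp.

Definition elem_map s : {omorphism dnat (size (undup s)) -> dpos K} :=
  of_tuple (@elem s : 'I__ -> dpos K).

(** A compatible family of maps on the finite subsets is determined by its
    restrictions to the singletons. *)
Lemma finite_colimit : is_colimit (D := finite_diagram) elem_map.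
Proof.
split.
- by move=> s t f i; apply: elem_enlarge.
- move=> E u uP.
  pose v (x : K) := u [:: x] (position (mem_head x [::])).
  have vP s i : v (elem (s := s) i) = u s i.
    have f : inclusion [:: elem i] s.
      by apply: subset_inclusion => x; rewrite inE => /eqP->; apply: elem_mem.
    rewrite -[LHS](uP _ _ f) /mcomp/=; congr (u s _).
    by apply: elem_inj; rewrite elem_enlarge elem_position.
  exists (of_fun v); split=> [s i|v' v'P x]; first exact: vP.
  rewrite -[RHS]v'P /mcomp/=; congr (v' _).
  exact/esym/elem_position.
- move=> E v v' vv' x.
  by have := vv' [:: x] (position (mem_head x [::])); rewrite /mcomp/=
    /elem_map /= [of_tuple_fun _ _]elem_position.
Qed.
End FiniteSubsets.

(** * Posets as reflexive coinserters of discrete posets *)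

Section DiscreteCoinserter.
Variable X : Pos.

Definition order_pair := {p : X * X | p.1 <= p.2}.

Definition lower : {omorphism dpos order_pair -> dpos X} :=
  of_fun (fun p : order_pair => (val p).1 : dpos X).
Definition upper : {omorphism dpos order_pair -> dpos X} :=
  of_fun (fun p : order_pair => (val p).2 : dpos X).
Definition undiscrete : {omorphism dpos X -> X} := of_fun (fun x : X => x).

Lemma lower_upper_reflexive : reflexive_pair lower upper.
Proof.
pose i (x : X) : dpos order_pair := exist (fun p => p.1 <= p.2) (x, x) (lexx x).
by exists (of_fun i).
Qed.

(** A map out of the set X puts the two projections in order exactly when it is
    monotone for the order of X. *)
Lemma undiscrete_coinserter : is_coinserter lower upper undiscrete.
Proof.
split=> [[p pP]||] //=.
move=> D u uP.
have u_homo : {homo (u : X -> D) : x y / x <= y}.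
  by move=> x y xy; apply: (uP (exist (fun p => p.1 <= p.2) (x, y) xy)).
by exists (monotone_map u_homo).
Qed.
End DiscreteCoinserter.

(** * Kleisli calculus *)

Section Kleisli.
Variable T : monad.
Implicit Types X Y Z : Pos.

Lemma kstar_eta X Y (k : {omorphism X -> T Y}) x : kstar k (eta T X x) = k x.
Proof.
rewrite /kstar/mcomp/=.
by rewrite [fmap T k _](@eta_natural T _ _ k) [LHS](@mu_eta T Y).
Qed.

Lemma kstar_ext X Y (k l : {omorphism X -> T Y}) : k =1 l -> kstar k =1 kstar l.
Proof. by move=> kl x; rewrite /kstar/mcomp/= (fmap_ext kl). Qed.

Lemma kstar_mono X Y (k l : {omorphism X -> T Y}) :
  mle k l -> mle (kstar k) (kstar l).
Proof. by move=> kl x; apply: (omorph_le (mu T Y)); apply: fmap_mono. Qed.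

Lemma kstar_unit X (x : T X) : kstar (eta T X) x = x.
Proof. exact: mu_fmap_eta. Qed.

(** This law for T f, like [mu_kstar] for mu and [kstar_kstar] for l^*, says
    that the map preserves the operations s(k) = k^*(s) of the algebras T X. *)
Lemma fmap_kstar X Y Z (f : {omorphism Y -> Z}) (k : {omorphism X -> T Y}) x :
  fmap T f (kstar k x) = kstar (mcomp (fmap T f) k) x.
Proof.
rewrite /kstar/mcomp/= [LHS](@mu_natural T _ _ f) /mcomp/=; congr (mu T Z _).
by rewrite [RHS](@fmap_comp T).
Qed.

Lemma kstar_fmap X Y Z (k : {omorphism Y -> T Z}) (f : {omorphism X -> Y}) x :
  kstar k (fmap T f x) = kstar (mcomp k f) x.
Proof. by rewrite /kstar/mcomp/= [fmap T (_ \o _) x](@fmap_comp T). Qed.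

Lemma mu_kstar X Y (k : {omorphism X -> T (T Y)}) x :
  mu T Y (kstar k x) = kstar (mcomp (mu T Y) k) x.
Proof.
rewrite /kstar/mcomp/= [LHS]mu_mu /mcomp/=; congr (mu T Y _).
by rewrite [RHS](@fmap_comp T).
Qed.

Lemma kstar_kstar X Y Z (l : {omorphism Y -> T Z}) (k : {omorphism X -> T Y}) x :
  kstar l (kstar k x) = kstar (mcomp (kstar l) k) x.
Proof.
rewrite [LHS](congr1 (mu T Z) (fmap_kstar l k x)) mu_kstar.
exact: kstar_ext.
Qed.

Lemma fmapE X Y (f : {omorphism X -> Y}) x :
  fmap T f x = kstar (mcomp (eta T Y) f) x.
Proof. by rewrite -kstar_fmap kstar_unit. Qed.
End Kleisli.

(** * Algebras of the associated variety *)

Section AssociatedAlgebra.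
Variables (T : monad) (A : valgebra (associated_variety T)).

Lemma aop_ext n (s : T (dnat n)) (a b : 'I_n -> A) :
  a =1 b -> aop (a0 := A) s a = aop s b.
Proof.
by move=> ab; apply/le_anti/andP; split; apply: aop_mono => i; rewrite ab.
Qed.

(** Satisfaction quantifies over valuations of all the variables, while an
    operation only sees n of them; the default d takes care of the others.
    Since A may be empty, d has to come from the data of each law: the value
    of one of its sides, or one of the arguments, is always at hand. *)
Definition valuation n (d : A) (a : 'I_n -> A) (j : nat) : A :=
  oapp a d (insub j).

Lemma valuationE n d (a : 'I_n -> A) (i : 'I_n) : valuation d a i = a i.
Proof. by rewrite /valuation valK. Qed.

Lemma eval_op_term n d (a : 'I_n -> A) (s : T (dnat n)) :
  eval (valuation d a) (op_term s) = aop s a.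
Proof. by apply: aop_ext => i; apply: valuationE. Qed.

Lemma assoc_eq_eval u v (f : nat -> A) :
  assoc_eq (T := T) u v -> eval f u = eval f v.
Proof.
move=> uv; apply/le_anti/andP; split; apply: valgP.
  exact: assoc_ineq_eq.
exact: assoc_ineq_eq_sym.
Qed.

Lemma aop_le n (s t : T (dnat n)) (a : 'I_n -> A) :
  s <= t -> aop (a0 := A) s a <= aop t a.
Proof.
move=> st; pose d := aop (a0 := A) s a.
rewrite -!(eval_op_term d); apply: valgP.
exact: assoc_ineq_le.
Qed.

Lemma aop_eta n (i : 'I_n) (a : 'I_n -> A) :
  aop (a0 := A) (eta T (dnat n) i) a = a i.
Proof.
rewrite -(eval_op_term (a i)) (assoc_eq_eval _ (assoc_eq_unit _ i)).
exact: valuationE.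
Qed.

Lemma aop_kstar n m (k : 'I_m -> T (dnat n)) (s : T (dnat m)) (a : 'I_n -> A) :
  aop (a0 := A) (kstar (of_tuple k) s) a = aop s (fun j => aop (k j) a).
Proof.
pose d := aop (a0 := A) (kstar (of_tuple k) s) a.
rewrite -(eval_op_term d) (assoc_eq_eval _ (assoc_eq_subst _ _)) /=.
by apply: aop_ext => j; apply: (eval_op_term d a (k j)).
Qed.

(** Substituting the projections eta (g i) in the law for k^* reindexes the
    arguments. *)
Lemma aop_fmap m n (g : {omorphism dnat m -> dnat n}) (s : T (dnat m))
    (a : 'I_n -> A) :
  aop (a0 := A) (fmap T g s) a = aop s (fun i => a (g i)).
Proof.
rewrite fmapE (kstar_ext (l := of_tuple (fun i : 'I_m => eta T (dnat n) (g i))))//.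
by rewrite aop_kstar; apply: aop_ext => i; apply: aop_eta.
Qed.

Definition interpret_fun n (a : 'I_n -> A) (s : T (dnat n)) : A := aop s a.

Lemma interpret_homo n (a : 'I_n -> A) :
  {homo interpret_fun a : s t / s <= t}.
Proof. by move=> s t; apply: aop_le. Qed.

(** The extension of the tuple a to T n. *)
Definition interpret n (a : 'I_n -> A) : {omorphism T (dnat n) -> A} :=
  monotone_map (interpret_homo a).
End AssociatedAlgebra.

Section MonadAlgebra.
Variables (T : monad) (X : Pos).

Definition monad_op n (s : T (dnat n)) (k : 'I_n -> T X) : T X :=
  kstar (of_tuple k) s.

Fact monad_op_mono n (s : T (dnat n)) (k l : 'I_n -> T X) :
  (forall i, k i <= l i) -> monad_op s k <= monad_op s l.
Proof. by move=> kl; apply: kstar_mono. Qed.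

Definition monad_alg : algebra (assoc_sig T) :=
  @Algebra (assoc_sig T) (T X) monad_op monad_op_mono.

Lemma monad_alg_eq u v (f : nat -> monad_alg) :
  assoc_eq (T := T) u v -> eval f u = eval f v.
Proof.
case=> [n m k s|n i] /=; last exact: kstar_eta.
by rewrite /monad_op kstar_kstar; apply: kstar_ext.
Qed.

Fact monad_alg_satisfies : satisfies (V := associated_variety T) monad_alg.
Proof.
move=> u v [n s t st|{}u {}v uv|{}u {}v uv] f.
- exact: (omorph_le (kstar _)).
- by rewrite (monad_alg_eq _ uv).
- by rewrite (monad_alg_eq _ uv).
Qed.

Definition monad_valg : valgebra (associated_variety T) :=
  VAlgebra monad_alg_satisfies.
End MonadAlgebra.

Section MonadAlgebraHom.
Variables (T : monad) (X Y : Pos).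

Lemma fmap_hom (f : {omorphism X -> Y}) :
  is_hom (A := monad_valg T X) (B := monad_valg T Y) (fmap T f).
Proof. by move=> n s k; rewrite [LHS]fmap_kstar; apply: kstar_ext. Qed.

Lemma mu_hom : is_hom (A := monad_valg T (T X)) (B := monad_valg T X) (mu T X).
Proof. by move=> n s k; rewrite [LHS]mu_kstar; apply: kstar_ext. Qed.
End MonadAlgebraHom.

(** * Freeness *)

Section StronglyFinitary.
Variables (T : monad) (sfT : strongly_finitary T).

Let T_filtered (K : choiceType) :
    is_colimit (D := map_diagram T (finite_diagram K))
      (fun t => fmap T (elem_map t)) :=
  sfT.1 _ _ _ _ (finite_subsets_filtered K) (finite_colimit K).

Let T_coinserter (X : Pos) :
    is_coinserter (fmap T (lower X)) (fmap T (upper X)) (fmap T (undiscrete X)) :=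
  sfT.2 _ _ _ _ _ _ (lower_upper_reflexive X) (undiscrete_coinserter X).

Definition points (X : Pos) (t : seq X) : {omorphism dnat (size (undup t)) -> X} :=
  of_tuple (@elem X t).

(** The images under T of the two colimits that present X are covered by their
    legs, and the legs out of T of a finite discrete poset are T of tuples. *)
Lemma finite_support (X : Pos) (x : T X) :
  exists (t : seq X) (s : T (dnat (size (undup t)))), x = fmap T (points t) s.
Proof.
move: x; apply: (coinserter_cover (T_coinserter X)) => y.
suff [t [s ->]] : exists (t : seq X) (s : T (dnat (size (undup t)))),
    y = fmap T (elem_map t) s.
  by exists t, s; rewrite -[LHS](@fmap_comp T); apply: fmap_ext.
by move: y; apply: (colimit_cover (T_filtered X)) => t s; exists t, s.
Qed.

(** Finitely many supports are all contained in their union. *)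
Lemma common_support (X : Pos) n (k : 'I_n -> T X) :
  exists (t : seq X) (l : 'I_n -> T (dnat (size (undup t)))),
  forall i, k i = fmap T (points t) (l i).
Proof.
have /fin_all_exists[t tP] i : exists t : seq X,
    exists s : T (dnat (size (undup t))), k i = fmap T (points t) s.
  exact: finite_support.
exists (flatten [seq t i | i : 'I_n]).
apply: (@fin_all_exists _ (fun=> _)
  (fun i s => k i = fmap T (points _) s)) => i.
have [s ->] := tP i.
have [|g gP] := @factor_elem X _ (@elem X (t i)) (flatten [seq t i | i : 'I_n]).
  move=> j; apply/flattenP; exists (t i); last exact: elem_mem.
  by apply/mapP; exists i; rewrite ?mem_enum.
exists (fmap T g s); rewrite -[RHS](@fmap_comp T); apply: fmap_ext => j.
exact/esym/gP.
Qed.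

Section Extension.
Variable A : valgebra (associated_variety T).

(** Gluing along the filtered colimit of finite subsets.  The formula is stated
    for all tuples, not only for enumerations of subsets, since it will be
    applied to the composites of an enumeration with the two projections. *)
Lemma discrete_extension (K : choiceType) (f : K -> A) :
  exists h : {omorphism T (dpos K) -> A},
  forall n (s : {omorphism dnat n -> dpos K}) (x : T (dnat n)),
  h (fmap T s x) = aop x (fun i => f (s i)).
Proof.
have [_ /(_ A (fun t : seq K => interpret (fun i => f (elem (s := t) i))))] :=
  T_filtered K.
case=> [t u g x|h [hP _] _].
  rewrite /mcomp/= [LHS]aop_fmap; apply: aop_ext => i.
  by rewrite elem_enlarge.
exists h => n s x.
pose t : seq K := [seq (s i : K) | i : 'I_n].
have [|g gP] := @factor_elem K n s t.
  by move=> i; apply/mapP; exists i; rewrite ?mem_enum.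
have sE : s =1 mcomp (elem_map t) g by move=> i; apply/esym/gP.
rewrite (fmap_ext sE) (@fmap_comp T) [LHS](hP t) [LHS]aop_fmap.
by apply: aop_ext => i; rewrite gP.
Qed.

(** The extension from the set X descends along the coinserter: the inequality
    required holds on T of the set of pairs x <= y because it holds at every
    operation, by monotonicity of f and of the operations of A. *)
Lemma monad_extension (X : Pos) (f : {omorphism X -> A}) :
  exists h : {omorphism T X -> A},
  forall (t : seq X) x, h (fmap T (points t) x) = aop x (fun i => f (points t i)).
Proof.
have [h0 h0P] := discrete_extension (f : X -> A).
have [_ /(_ A h0) ext_ _] := T_coinserter X.
have [|h [hP _]] := ext_.
  have [_ _] := T_filtered (order_pair X); apply=> t x; rewrite /mcomp/=.
  rewrite -[fmap T (lower X) _](@fmap_comp T) -[fmap T (upper X) _](@fmap_comp T).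
  rewrite !h0P; apply: aop_mono => i; apply: (omorph_le f).
  exact: (valP (elem i : order_pair X)).
exists h => t x.
rewrite (fmap_ext (g := mcomp (undiscrete X) (elem_map t)))//.
by rewrite (@fmap_comp T) [LHS]hP h0P.
Qed.

Definition monad_ext (X : Pos) (f : {omorphism X -> A}) : {omorphism T X -> A} :=
  sval (cid (monad_extension f)).

Lemma monad_extE (X : Pos) (f : {omorphism X -> A}) (t : seq X) x :
  monad_ext f (fmap T (points t) x) = aop x (fun i => f (points t i)).
Proof. exact: (svalP (cid (monad_extension f))). Qed.

(** With a common support t of the tuple k, say k_i = T t (l_i), both sides
    become values of operations at f t, and the law for k^* identifies them:
    s(k) = T t (l^*(s)) goes to (l^*(s))_A(f t) = s_A(i |-> (l_i)_A(f t)). *)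
Lemma monad_ext_hom (X : Pos) (f : {omorphism X -> A}) :
  is_hom (A := monad_valg T X) (monad_ext f).
Proof.
move=> n s k; have [t [l kl]] := common_support k.
rewrite -[aop s k]/(kstar (of_tuple k) s).
rewrite (kstar_ext (l := mcomp (fmap T (points t)) (of_tuple l))) //.
rewrite -fmap_kstar monad_extE aop_kstar; apply: aop_ext => i.
by rewrite kl monad_extE.
Qed.

(** T t (s) is the value of s at the tuple eta t, so homomorphisms are determined
    by their values on eta. *)
Lemma hom_points (X : Pos) (h : {omorphism T X -> A}) (t : seq X) x :
  is_hom (A := monad_valg T X) h ->
  h (fmap T (points t) x) = aop x (fun i => h (eta T X (points t i))).
Proof.
move=> hh; rewrite -[RHS](hh _ x) fmapE; congr (h _).
exact: kstar_ext.
Qed.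

Lemma monad_ext_unit (X : Pos) (f : {omorphism X -> A}) :
  mcomp (monad_ext f) (eta T X) =1 f.
Proof.
move=> x; rewrite /mcomp/=.
pose i : dnat _ := position (mem_head x [::]).
have xE : points [:: x] i = x by apply: elem_position.
rewrite -{1}xE -[eta T X _](@eta_natural T _ _ (points [:: x])).
by rewrite [LHS]monad_extE [LHS]aop_eta xE.
Qed.

Lemma monad_ext_uniq (X : Pos) (f : {omorphism X -> A})
    (h : {omorphism T X -> A}) :
  is_hom (A := monad_valg T X) h -> mcomp h (eta T X) =1 f -> h =1 monad_ext f.
Proof.
move=> hh hf x; have [t [s ->]] := finite_support x.
by rewrite hom_points // monad_extE; apply: aop_ext => i; apply: hf.
Qed.

Lemma monad_ext_mono (X : Pos) (f g : {omorphism X -> A}) :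
  mle f g -> mle (monad_ext f) (monad_ext g).
Proof.
move=> fg x; have [t [s ->]] := finite_support x.
by rewrite !monad_extE; apply: aop_mono => i; apply: fg.
Qed.
End Extension.

Definition monad_free_algebras : free_algebras (associated_variety T) :=
  @FreeAlgebras (associated_variety T) (monad_valg T) (eta T)
    (fun X A f => monad_ext f) (fun X A f => @monad_ext_hom A X f)
    (fun X A f => @monad_ext_unit A X f)
    (fun X A f h => @monad_ext_uniq A X f h)
    (fun X A f g => @monad_ext_mono A X f g).
End StronglyFinitary.

(** * Comparison of monads *)

Lemma monad_morphism_comp (R S T : monad) (psi : forall X, {omorphism S X -> T X})
    (phi : forall X, {omorphism R X -> S X}) :
  monad_morphism psi -> monad_morphism phi ->
  monad_morphism (fun X => mcomp (psi X) (phi X)).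
Proof.
move=> [psi_nat psi_eta psi_mu] [phi_nat phi_eta phi_mu]; split.
- move=> X Y f x; rewrite /mcomp/= [LHS](psi_nat _ _ f).
  exact: (congr1 (psi Y) (phi_nat _ _ f x)).
- move=> X x; rewrite -[RHS](psi_eta X).
  exact: (congr1 (psi X) (phi_eta X x)).
- move=> X x; rewrite [LHS](congr1 (psi X) (phi_mu X x)) [LHS]psi_mu.
  congr (mu T X _); rewrite /mcomp/= [fmap R (_ \o _) x](@fmap_comp R).
  congr (psi (T X) _); exact: (phi_nat _ _ (psi X)).
Qed.

Lemma monad_iso_trans (R S T : monad) :
  monad_iso R S -> monad_iso S T -> monad_iso R T.
Proof.
move=> [f [f' [fM f'M f'f ff']]] [g [g' [gM g'M g'g gg']]].
exists (fun X => mcomp (g X) (f X)), (fun X => mcomp (f' X) (g' X)); split.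
- exact: monad_morphism_comp.
- exact: monad_morphism_comp.
- by move=> X x; rewrite -[RHS](f'f X); apply: (congr1 (f' X) (g'g X (f X x))).
- by move=> X x; rewrite -[RHS](gg' X); apply: (congr1 (g X) (ff' X (g' X x))).
Qed.

Section FreeComparison.
Variable V : variety.

Definition comparison (F G : free_algebras V) (X : Pos) :
  {omorphism free F X -> free G X} := ext F (funit G X).

Lemma comparison_hom F G X : is_hom (comparison F G X).
Proof. exact: ext_hom. Qed.

Lemma comparison_unit F G (X : Pos) (x : X) :
  comparison F G X (funit F X x) = funit G X x.
Proof. exact: ext_unit. Qed.

(** All the identities between comparison maps hold because both sides are
    homomorphisms out of a free algebra that agree on the generators. *)
Lemma comparisonK F G X : mcomp (comparison G F X) (comparison F G X) =1 midmap _.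
Proof.
apply: hom_eq; [exact/hom_comp/comparison_hom/comparison_hom|exact: hom_id|].
by move=> x; rewrite /mcomp/= !comparison_unit.
Qed.

Lemma comparison_morphism F G :
  monad_morphism (S := free_monad F) (T := free_monad G) (comparison F G).
Proof.
split.
- move=> X Y f; apply: hom_eq.
  + exact: hom_comp (@free_fmap_hom _ G _ _ f) (@comparison_hom F G X).
  + exact: hom_comp (@comparison_hom F G _) (@free_fmap_hom _ F _ _ _).
  move=> x; rewrite /mcomp/= comparison_unit.
  rewrite [free_fmap F f _](@free_fmap_unit _ F) /mcomp/= comparison_unit.
  exact: free_fmap_unit.
- by move=> X x; apply: comparison_unit.
- move=> X; apply: hom_eq.
  + exact: hom_comp (@comparison_hom F G X) (@free_mu_hom _ F X).
  + apply: hom_comp (@free_mu_hom _ G X) _.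
    exact: hom_comp (@comparison_hom F G _) (@free_fmap_hom _ F _ _ _).
  move=> x; rewrite /mcomp/= [free_mu F X _](@free_mu_eta _ F).
  rewrite [free_fmap F _ _](@free_fmap_unit _ F) /mcomp/= comparison_unit.
  by rewrite [RHS](@free_mu_eta _ G).
Qed.

Lemma free_monad_iso (F G : free_algebras V) : monad_iso (free_monad F) (free_monad G).
Proof.
exists (comparison F G), (comparison G F).
by split; [exact: comparison_morphism..|exact: comparisonK|exact: comparisonK].
Qed.
End FreeComparison.

(** The functor and the multiplication induced by the adjunction are those of T,
    because T f and mu are homomorphisms with the right values on eta; the
    carriers are equal, so identities give the isomorphism. *)
Lemma monad_iso_monad_free (T : monad) (sfT : strongly_finitary T) :
  monad_iso T (free_monad (monad_free_algebras sfT)).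
Proof.
set G := monad_free_algebras sfT.
have fmapG (X Y : Pos) (f : {omorphism X -> Y}) : fmap (free_monad G) f =1 fmap T f.
  move=> x; apply/esym/(monad_ext_uniq sfT (A := monad_valg T Y) (fmap_hom f)).
  exact: eta_natural.
have muG (X : Pos) : mu (free_monad G) X =1 mu T X.
  move=> x; apply/esym/(monad_ext_uniq sfT (A := monad_valg T X) (@mu_hom T X)).
  exact: mu_eta.
exists (fun X => midmap (T X)), (fun X => midmap (T X)); split=> //.
- split=> [X Y f x||X x] //; first exact: fmapG.
  by rewrite [RHS]muG /mcomp/= [fmap T _ _]fmap_id.
- split=> [X Y f x||X x] //; first exact/esym/fmapG.
  rewrite [LHS]muG; apply/esym/(congr1 (mu T X)).
  by rewrite [LHS](fmapG _ _ (midmap (T X))) fmap_id.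
Qed.

(* Free algebras of the associated variety exist, and for any choice of them
   (i.e. of the left adjoint) the resulting monad is isomorphic to T. *)
Theorem theorem4p4 (T : monad) (sfT : strongly_finitary T) :
  inhabited (free_algebras (associated_variety T)) /\
  forall F : free_algebras (associated_variety T), monad_iso T (free_monad F).
Proof.
split; first by exists; exact: monad_free_algebras sfT.
move=> F; apply: monad_iso_trans (monad_iso_monad_free sfT) _.
exact: free_monad_iso.
Qed.
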